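(* Let $J = \{J_l : 1 \le l \le N\}$ be a partition of $\mathbb{T}$ into finitely many intervals. There is a dense $G_\delta$ set $\mathcal{R} \subset \mathbb{T}$ such that for every $\alpha \in \mathcal{R}$ we have $R(s(\alpha,\beta,\gamma,J)) = T(s(\alpha,\beta,\gamma,J)) = \infty$ for Lebesgue almost every $(\beta,\gamma) \in \mathbb{T}^2$.
   Context: $\mathbb{T} = \mathbb{R}/\mathbb{Z}$. For $(\alpha,\beta,\gamma) \in \mathbb{T}^3$, $s(\alpha,\beta,\gamma,J) = (s_n)_{n\in\mathbb{Z}}$ denotes the coding of $\alpha n^2 + \beta n + \gamma$ (in $\mathbb{T}$) with respect to $J$, i.e. $s_n = \sum_{l=1}^N \lambda_l \chi_{J_l}(\alpha n^2 + \beta n + \gamma)$ with distinct numbers $\lambda_1,\ldots,\lambda_N$. For a two-sided sequence $\omega = (\omega_k)_{k\in\mathbb{Z}}$ over a finite alphabet and $n \ge 1$, let $R_n(\omega) = 1 + \frac{1}{n} \sup \{ m : \omega_k = \omega_{k+n} \text{ for } 1 \le k \le m \}$ and $T_n(\omega) = 1 + \frac{1}{n} \sup \{ m : \omega_k = \omega_{k+n} \text{ and } \omega_{n+1-k} = \omega_{1-k} \text{ for } 1 \le k \le m \}$, where $m$ ranges over positive integers and $\sup\emptyset = 0$; set $R(\omega) = \limsup_{n\to\infty} R_n(\omega)$ and $T(\omega) = \limsup_{n\to\infty} T_n(\omega)$, elements of $[1,\infty]$. *)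

(* Defs.v *)
From HB Require Import structures.
From mathcomp Require Import all_boot all_order all_algebra.
From mathcomp Require Import all_classical all_reals all_analysis.
From mathcomp Require Import measurable_realfun borel_hierarchy.
Import Order.TTheory GRing.Theory Num.Theory.
Import numFieldNormedType.Exports.

#[local] Set Warnings "-redundant-canonical-projection".
Set Implicit Arguments.
Unset Strict Implicit.
Unset Printing Implicit Defensive.

Local Open Scope classical_set_scope.
Local Open Scope ring_scope.
Local Open Scope quotient_scope.

Definition integers (R : realType) : zmodClosed R :=
  GRing.ZmodClosed.clone R (@Num.int_num_subdef R) _.

Definition circle (R : realType) : Type := {ideal_quot (integers R)}.

HB.instance Definition _ (R : realType) := GRing.Zmodule.on (circle R).
HB.instance Definition _ (R : realType) := EqQuotient.on (circle R).
HB.instance Definition _ (R : realType) := isPointed.Build (circle R) 0.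

Definition circle_pi (R : realType) (x : R) : circle R := \pi_(circle R) x.

Lemma circle_pi_eq (R : realType) (x y : R) :
  (circle_pi x == circle_pi y) = (x - y \is a Num.int).
Proof. by rewrite /circle_pi -Quotient.idealrBE. Qed.

Lemma circle_piD (R : realType) : {morph @circle_pi R : x y / x + y}.
Proof. by move=> x y; rewrite /circle_pi !piE. Qed.

Section circle_topology.
Variable R : realType.

Definition circle_open (U : set (circle R)) : Prop :=
  open (@circle_pi R @^-1` U).

Let circle_openT : circle_open setT. Proof. exact: openT. Qed.

Let circle_openI (A B : set (circle R)) :
  circle_open A -> circle_open B -> circle_open (A `&` B).
Proof. exact: openI. Qed.

Let circle_open_bigU (I : Type) (f : I -> set (circle R)) :
  (forall i, circle_open (f i)) -> circle_open (\bigcup_i f i).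
Proof. by move=> fo; apply: bigcup_open => i _; exact: fo. Qed.

HB.instance Definition _ := @isOpenTopological.Build (circle R) circle_open
  circle_openT circle_openI circle_open_bigU.

Lemma circle_pi_continuous : continuous (@circle_pi R).
Proof. exact/continuousP. Qed.

End circle_topology.

Section circle_measure.
Variable R : realType.

HB.instance Definition _ := @isMeasurable.Build
  (sigma_display (@open (circle R))) (circle R) <<s @open (circle R) >>
  (@sigma_algebra0 _ setT _) (@sigma_algebraC _ _)
  (@sigma_algebra_bigcup _ setT _).

Lemma measurable_circle_pi : measurable_fun [set: R] (@circle_pi R).
Proof.
apply: (@measurability _ _ _ _ setT _ (@open (circle R))) => //.
move=> _ [U oU <-]; rewrite setTI.
exact: open_measurable.
Qed.

(* The image of Lebesgue measure on [0, 1[, a fundamental domain of R / Z. *)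
Definition circle_lebesgue : set (circle R) -> \bar R :=
  pushforward (mrestr lebesgue_measure (measurable_itv `[0%R, 1%R[))
    (@circle_pi R).

Let circle_lebesgue0 : circle_lebesgue set0 = 0%E.
Proof. by rewrite /circle_lebesgue /pushforward preimage_set0 measure0. Qed.

Let circle_lebesgue_ge0 A : (0 <= circle_lebesgue A)%E.
Proof. by rewrite /circle_lebesgue /pushforward /mrestr. Qed.

Let circle_lebesgue_sigma_additive : semi_sigma_additive circle_lebesgue.
Proof.
have mpre (A : set (circle R)) : measurable A ->
    measurable (@circle_pi R @^-1` A : set (measurableTypeR R)).
  by move=> mA; rewrite -[X in measurable X]setTI; exact: measurable_circle_pi.
move=> F mF tF mUF; rewrite /circle_lebesgue /pushforward preimage_bigcup.
apply: measure_semi_sigma_additive => [n||].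
- exact: mpre.
- apply/trivIsetP => i j _ _ ij; rewrite -preimage_setI.
  by move/trivIsetP : tF => /(_ i j Logic.I Logic.I ij) ->;
    rewrite preimage_set0.
- by rewrite -preimage_bigcup; exact: mpre.
Qed.

HB.instance Definition _ := isMeasure.Build _ _ _ circle_lebesgue
  circle_lebesgue0 circle_lebesgue_ge0 circle_lebesgue_sigma_additive.

Let circle_lebesgue_setT : circle_lebesgue [set: circle R] = 1%E.
Proof.
rewrite /circle_lebesgue /pushforward /mrestr preimage_setT setTI.
by rewrite lebesgue_measure_itv /= lte_fin ltr01 oppr0 adde0.
Qed.

HB.instance Definition _ :=
  Measure_isProbability.Build _ _ _ circle_lebesgue circle_lebesgue_setT.
End circle_measure.
Arguments circle_lebesgue R : clear implicits.

(* An interval of R / Z is the image of an interval of R: it may be open, closed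
   or half-open, a single point, or (when the length is large) the whole
   circle. *)
Definition circle_interval (R : realType) (A : set (circle R)) : Prop :=
  exists2 I : set R, is_interval I & A = @circle_pi R @` I.

Definition coding (R : realType) (N : nat) (J : 'I_N -> set (circle R))
    (lambda : 'I_N -> R) (alpha beta gamma : circle R) (n : int) : R :=
  \sum_(l < N) lambda l * \1_(J l) (alpha *~ (n ^+ 2) + beta *~ n + gamma).

(* The supremum of a set of positive integers, with [sup set0 = 0]. *)
Definition nat_sup (R : realType) (M : set nat) : \bar R :=
  ereal_sup ([set 0%E] `|` [set m%:R%:E | m in M]).

Definition forward_match (A : Type) (omega : int -> A) (n m : nat) : Prop :=
  forall k : nat, (1 <= k <= m)%N -> omega k%:Z = omega (k%:Z + n%:Z).

Definition two_sided_match (A : Type) (omega : int -> A) (n m : nat) : Prop :=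
  forall k : nat, (1 <= k <= m)%N ->
    omega k%:Z = omega (k%:Z + n%:Z) /\
    omega (n%:Z + 1 - k%:Z) = omega (1 - k%:Z).

(* [rep_R_n] and [rep_T_n] are meaningful for [n >= 1]; their junk value at
   [n = 0] does not affect the upper limits. *)
Definition rep_R_n (R : realType) (A : Type) (omega : int -> A) (n : nat) :
    \bar R :=
  (1 + (n%:R^-1)%:E *
     nat_sup R [set m | (0 < m)%N /\ forward_match omega n m])%E.

Definition rep_T_n (R : realType) (A : Type) (omega : int -> A) (n : nat) :
    \bar R :=
  (1 + (n%:R^-1)%:E *
     nat_sup R [set m | (0 < m)%N /\ two_sided_match omega n m])%E.

Definition rep_R (R : realType) (A : Type) (omega : int -> A) : \bar R :=
  limn_esup (rep_R_n R omega).

Definition rep_T (R : realType) (A : Type) (omega : int -> A) : \bar R :=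
  limn_esup (rep_T_n R omega).

(* Main.v *)
Require Import Defs.
From mathcomp Require Import all_boot all_order all_algebra.
From mathcomp Require Import all_classical all_reals all_analysis.
From mathcomp Require Import measurable_realfun borel_hierarchy.
From mathcomp Require Import lra ring zify.
Import Order.TTheory GRing.Theory Num.Theory.
Import numFieldNormedType.Exports.

Local Open Scope classical_set_scope.
Local Open Scope ring_scope.

(** The coding at times t and t + n agrees as soon as the points
    x_t = alpha t^2 + beta t + gamma and x_(t+n) are closer to each other than
    x_t is to the finite set of endpoints of the J_l.  Since
      x_(t+n) - x_t = 2 alpha n t + alpha n^2 + beta n,
    suppose that alpha is extremely close to a fraction p / q and take
    n = q k: modulo 1 the terms containing alpha nearly vanish for all
    |t| <= C n, and the displacement is essentially beta q k, whatever t is.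
    To obtain two-sided repetitions of length C n, two things remain.

    - The displacement must be small compared with 1 / n, because about C n
      points x_t have to avoid a neighbourhood of the endpoints that is as
      large as the displacement.  Dirichlet's theorem alone only gives a
      displacement below 1 / k = q / n.  But for fixed q and c > 0, almost every beta has
      some k with q k beta within c / k of an integer: the exceptional
      (badly approximable) beta form a null set by Lebesgue's density theorem
      ([badly_approximable_null]).  Hence k may be bounded by some K
      depending only on q and c, outside a set of beta of small measure
      ([unapproximable_small]), and alpha is required to be so close to p / q
      that the drift stays below c / k for all k <= K.

    - For such a beta, the gamma for which some x_t comes too close to an
      endpoint have measure at most a constant times C q c, the factor k
      cancelling ([xsection_no_good_return]); this is small if c is chosen
      small in terms of C, q and the number of endpoints.

    The admissible alpha at level C = j + 1 form an open set.  The fractions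
    p / q are not required to be reduced, so every rational alpha belongs to
    the set of every level and the intersection of all levels is a dense
    G_delta.  For alpha in it, the pairs (beta, gamma) without a good
    repetition at level j have measure O(1 / j), hence almost every pair has
    good repetitions at infinitely many levels ([liminf_negligible]), and then
    both upper limits are infinite ([rep_infinite]). *)

Set Implicit Arguments.
Unset Strict Implicit.
Unset Printing Implicit Defensive.

(** * Closeness to the integers *)

Definition near_int {R : realType} (e : R) : set R :=
  [set x | exists p : int, `|x - p%:~R| < e].

Lemma near_int_shift (R : realType) (e x : R) (m : int) :
  near_int e (x + m%:~R) <-> near_int e x.
Proof.
split=> -[p xp]; [exists (p - m)|exists (p + m)].
  by rewrite (_ : _ - _ = x + m%:~R - p%:~R)// intrB; ring.
by rewrite intrD opprD addrACA subrr addr0.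
Qed.

Lemma near_intD (R : realType) (e e' x y : R) :
  near_int e x -> near_int e' y -> near_int (e + e') (x + y).
Proof.
move=> [p xp] [r yr]; exists (p + r); rewrite intrD opprD addrACA.
by apply: (le_lt_trans (ler_normD _ _)); exact: ltrD.
Qed.

Lemma open_near_int (R : realType) (e : R) : open (near_int e).
Proof.
have -> : near_int e = \bigcup_(p : int) ball (p%:~R : R) e.
  apply/seteqP; split=> x [p].
    by exists p => //; rewrite /ball /= distrC.
  by rewrite /ball /= => _; exists p; rewrite distrC.
by apply: bigcup_open => p _; exact: ball_open.
Qed.

(** Pigeonhole: among the M + 1 fractional parts of 0, x, ..., M x two lie in
    the same interval [l / M, (l + 1) / M[. *)
Lemma dirichlet (R : realType) (x : R) (M : nat) : (0 < M)%N ->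
  exists2 k : nat, (0 < k <= M)%N & near_int (M%:R^-1) (k%:R * x).
Proof.
move=> M0; have M0R : (0 : R) < M%:R by rewrite ltr0n.
pose fr (i : nat) : R := i%:R * x - (Num.floor (i%:R * x))%:~R.
have fr0 i : 0 <= fr i by rewrite subr_ge0 ge_floor.
have fr1 i : fr i < 1.
  by rewrite ltrBlDr addrC -[1]/(1%:~R) -intrD; exact: floorD1_gt.
have bxl i : (Num.truncn (M%:R * fr i) < M)%N.
  rewrite truncn_lt_nat; last by rewrite mulr_ge0// ltW.
  by rewrite gtr_pMr.
pose box (i : 'I_M.+1) : 'I_M := Ordinal (bxl i).
have /injectivePn[i [i' neq eqb]] : ~~ injectiveb box.
  apply/negP => /injectiveP /leq_card; by rewrite !card_ord ltnn.
wlog ltii : i i' neq eqb / (i < i')%N.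
  move=> W; have := neq; rewrite -val_eqE /= neq_ltn => /orP[|] h.
    exact: (W i i').
  by apply: (W i' i) => //; rewrite eq_sym.
exists (i' - i)%N; first by have := ltn_ord i'; lia.
exists (Num.floor (i'%:R * x) - Num.floor (i%:R * x)).
rewrite natrB ?(ltnW ltii)// intrB.
have -> : (i'%:R - i%:R) * x -
  ((Num.floor (i'%:R * x))%:~R - (Num.floor (i%:R * x))%:~R) = fr i' - fr i.
  by rewrite /fr; ring.
have /(congr1 val)/= eqt := eqb.
have h j : (Num.truncn (M%:R * fr j))%:R <= M%:R * fr j <
   (Num.truncn (M%:R * fr j)).+1%:R.
  by apply: truncn_itv; rewrite mulr_ge0// ltW.
have /andP[h1 h2] := h i; have /andP[h3 h4] := h i'.
rewrite -[ltRHS]mul1r ltr_pdivlMr// -(ger0_norm (ltW M0R)) -normrM.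
rewrite -eqt in h3 h4; rewrite mulrBl ltr_norml.
move: h1 h2 h3 h4; rewrite -natr1 ![M%:R * _]mulrC => *.
by apply/andP; split; lra.
Qed.

(** * Real representatives of points of the circle *)

Lemma circle_pi0 (R : realType) : circle_pi (0 : R) = 0.
Proof. by apply: (addIr (circle_pi 0)); rewrite -circle_piD !add0r. Qed.

Lemma circle_piN (R : realType) (x : R) : circle_pi (- x) = - circle_pi x.
Proof. by apply: (addIr (circle_pi x)); rewrite -circle_piD !addNr circle_pi0. Qed.

Lemma circle_pi_mulrz (R : realType) (x : R) (n : int) :
  circle_pi (x * n%:~R) = circle_pi x *~ n.
Proof.
have nat_case (m : nat) : circle_pi (x * m%:R) = circle_pi x *+ m.
  elim: m => [|m IH]; first by rewrite mulr0 mulr0n circle_pi0.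
  by rewrite [RHS]mulrS -natr1 mulrDr mulr1 addrC circle_piD IH.
case: n => m; first exact: nat_case.
by rewrite NegzE [RHS]mulrNz intrN mulrN circle_piN; congr (- _); exact: nat_case.
Qed.

Lemma circle_pi_surj (R : realType) (u : circle R) :
  exists x : R, circle_pi x = u.
Proof. by exists (repr u); rewrite /circle_pi reprK. Qed.

Lemma circle_piP (R : realType) (x y : R) :
  circle_pi x = circle_pi y <-> exists p : int, x = y + p%:~R.
Proof.
split=> [/eqP|[p ->]].
  by rewrite circle_pi_eq => /intrP[p xyp]; exists p; rewrite -xyp addrC subrK.
by apply/eqP; rewrite circle_pi_eq addrAC subrr add0r; apply/intrP; exists p.
Qed.

Lemma circle_pi_open (R : realType) (U : set R) :
  open U -> open (@circle_pi R @` U).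
Proof.
move=> oU; rewrite /open/= /circle_open.
have -> : @circle_pi R @^-1` (@circle_pi R @` U) =
    \bigcup_(p : int) ((fun x : R => x + p%:~R) @^-1` U).
  apply/seteqP; split=> x /=.
    by move=> [y Uy /circle_piP[p yx]]; exists p => //=; rewrite -yx.
  by move=> [p _ /= Up]; exists (x + p%:~R) => //; apply/circle_piP; exists p.
apply: bigcup_open => p _; apply: open_comp => // x _.
by apply: cvgD; [exact: cvg_id|exact: cvg_cst].
Qed.

(** The representative in [0, 1[; unlike the canonical representative of the
    quotient, it is a measurable function. *)
Definition circle_rep {R : realType} (u : circle R) : R :=
  repr u - (Num.floor (repr u))%:~R.

Lemma circle_repK (R : realType) (u : circle R) : circle_pi (circle_rep u) = u.
Proof.
rewrite -[RHS]reprK; apply/circle_piP; exists (- Num.floor (repr u)).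
by rewrite intrN.
Qed.

Lemma circle_rep_itv (R : realType) (u : circle R) : 0 <= circle_rep u < 1.
Proof.
rewrite subr_ge0 ge_floor/= ltrBlDr addrC -[1]/(1%:~R) -intrD.
exact: floorD1_gt.
Qed.

Lemma circle_pi_inj01 (R : realType) (x y : R) :
  0 <= x < 1 -> 0 <= y < 1 -> circle_pi x = circle_pi y -> x = y.
Proof.
move=> /andP[x0 x1] /andP[y0 y1] /circle_piP[p xyp].
have p0 : p = 0.
  have : (-1)%:~R < p%:~R :> R by rewrite rmorphN1; lra.
  have : p%:~R < 1%:~R :> R by rewrite rmorph1; lra.
  by rewrite !ltr_int; lia.
by rewrite xyp p0 addr0.
Qed.

Lemma circle_piK (R : realType) (x : R) :
  0 <= x < 1 -> circle_rep (circle_pi x) = x.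
Proof.
by move=> x01; apply: circle_pi_inj01 => //;
  [exact: circle_rep_itv|exact: circle_repK].
Qed.

(** The measure on the circle is the image of Lebesgue measure on [0, 1[, where
    [circle_pi] and [circle_rep] are inverse to each other. *)
Lemma circle_lebesgue_rep (R : realType) (A : set R) :
  circle_lebesgue R (circle_rep @^-1` A) =
  lebesgue_measure (A `&` `[0, 1[ : set R).
Proof.
rewrite /circle_lebesgue /pushforward /mrestr; congr (lebesgue_measure _).
apply/seteqP; split=> x /= [Ax]; rewrite in_itv/= => x01.
  by move: Ax; rewrite circle_piK.
by rewrite circle_piK.
Qed.

(** The map [circle_rep] is discontinuous at 0, but the set where it exceeds
    a >= 0 is the image of the open interval ]a, 1[, hence open. *)
Lemma measurable_circle_rep (R : realType) :
  measurable_fun [set: circle R] (@circle_rep R).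
Proof.
apply: (measurability _ (RGenOInfty.measurableE R)) => //.
move=> _ [_ [a ->] <-]; rewrite setTI.
have [a0|a0] := ltP a 0.
  rewrite (_ : _ @^-1` _ = setT)//; apply/seteqP; split=> // u _ /=.
  rewrite in_itv/= andbT.
  by have /andP[+ _] := circle_rep_itv u; exact: lt_le_trans.
rewrite (_ : _ @^-1` _ = @circle_pi R @` `]a, 1[%classic).
  by apply: sub_sigma_algebra; apply: circle_pi_open; exact: itv_open.
apply/seteqP; split=> u /=; rewrite in_itv/=.
  rewrite andbT => au; exists (circle_rep u); last exact: circle_repK.
  by rewrite in_itv/= au; have /andP[] := circle_rep_itv u.
move=> [x]; rewrite in_itv/= => /andP[ax x1] <-.
by rewrite circle_piK ?andbT ?x1 ?(le_trans a0 (ltW ax)).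
Qed.

(** * Badly approximable numbers form a null set *)

(** The intersection over all K consists of the x such that q x is badly
    approximable, with constant c. *)
Definition unapproximable {R : realType} (c : R) (q K : nat) : set R :=
  [set x | forall k, (0 < k <= K)%N -> ~ near_int (c / k%:R) ((q * k)%:R * x)].

Lemma measurable_unapproximable (R : realType) (c : R) (q K : nat) :
  measurable (unapproximable c q K).
Proof.
apply: closed_measurable; rewrite -openC.
have -> : ~` unapproximable c q K = \bigcup_(k in [set k | (0 < k <= K)%N])
    (fun x => (q * k)%:R * x) @^-1` near_int (c / k%:R).
  apply/seteqP; split=> x /=.
    by move/existsNP => [k /not_implyP[kK /contrapT xk]]; exists k.
  by move=> [k /= kK xk] /(_ k kK).
apply: bigcup_open => k _; apply: open_comp; last exact: open_near_int.
by move=> x _; exact: mulrl_continuous.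
Qed.

(** Such a set has no density point.  By Dirichlet's theorem any x has, at
    arbitrarily small scales s, some z = p / (q k) at distance less than s, and
    the ball of radius c s around z avoids the set; so the set fills at most
    the proportion 1 - c / 2 of the ball of radius 2 s around x. *)
Lemma badly_approximable_null (R : realType) (c : R) (q : nat) :
  0 < c <= 1 -> (0 < q)%N ->
  lebesgue_measure (\bigcap_K unapproximable c q K) = 0%E.
Proof.
move=> /andP[c0 c1] q0; set A := \bigcap_K _.
have mA : measurable A.
  by apply: bigcapT_measurable => K; exact: measurable_unapproximable.
apply/negligibleP; first exact: mA.
have := lebesgue_density mA.
apply: negligibleS => x Ax /= cv.
have {cv} : \forall r \near (0 : R)^'+, ((1 - c / 4)%:E <
    lebesgue_measure (A `&` ball x r) * (lebesgue_measure (ball x r))^-1)%E.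
  have := cv [set y | ((1 - c / 4)%:E < y)%E]; apply.
  apply: open_nbhs_nbhs; split; first exact: open_ereal_gt_ereal.
  by rewrite /= indicE mem_set//= lte_fin; lra.
move=> [e /= e0 He].
(* The ball around x of radius 2 s, with s = 1 / (q k M), must have radius less
   than e whatever k >= 1 Dirichlet's theorem provides. *)
pose M := (Num.truncn (2 / e)).+1.
have M0 : (0 : R) < M%:R by rewrite ltr0n.
have eM : 2 < e * M%:R by rewrite -ltr_pdivrMl// mulrC; exact: truncnS_gt.
have [k /andP[k0 kM] [p]] := @dirichlet R (q%:R * x) M isT.
rewrite mulrA -natrM mulnC => xp.
have k0R : (0 : R) < k%:R by rewrite ltr0n.
have Q0 : (0 : R) < (q * k)%:R by rewrite ltr0n muln_gt0 q0.
have Q1 : (1 : R) <= (q * k)%:R by rewrite ler1n muln_gt0 q0.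
set Q := (q * k)%:R in xp Q0 Q1.
pose s := (Q * M%:R)^-1; pose z : R := p%:~R / Q.
have s0 : 0 < s by rewrite invr_gt0 mulr_gt0.
have Qs : Q * s = M%:R^-1 by rewrite /s invfM mulrA mulfV ?mul1r ?gt_eqF.
have xz : `|x - z| < s.
  rewrite -(ltr_pM2l Q0) Qs -{1}(gtr0_norm Q0) -normrM mulrBr.
  by rewrite /z mulrCA mulfV ?mulr1 ?gt_eqF.
have zA : A `&` ball z (c * s) = set0.
  apply/seteqP; split=> // y [Ay]; rewrite /ball/= => zy.
  apply: (Ay k I k); rewrite ?k0 ?leqnn//; exists p; rewrite -/Q.
  have -> : Q * y - p%:~R = Q * (y - z).
    by rewrite mulrBr /z [Q * (_ / _)]mulrCA mulfV ?mulr1 ?gt_eqF.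
  rewrite normrM (gtr0_norm Q0) distrC.
  apply: (@lt_le_trans _ _ (Q * (c * s))); first by rewrite ltr_pM2l.
  rewrite mulrCA Qs ler_pM2l// lef_pV2 ?posrE// ler_nat.
  exact: leq_trans kM _.
have sub : ball z (c * s) `<=` ball x (2 * s).
  move=> y; rewrite /ball/= => zy.
  have -> : x - y = (x - z) + (z - y) by ring.
  apply: (le_lt_trans (ler_normD _ _)).
  have : c * s <= s by rewrite ger_pMl.
  by move=> ?; lra.
have mux : lebesgue_measure (ball x (2 * s)) = ((2 * s) *+ 2)%:E.
  by rewrite lebesgue_measure_ball// mulr_ge0// ltW.
have muz : lebesgue_measure (ball z (c * s)) = ((c * s) *+ 2)%:E.
  by rewrite lebesgue_measure_ball// mulr_ge0// ltW.
have := He (2 * s); rewrite /ball /= sub0r normrN gtr0_norm ?mulr_gt0//.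
have se : 2 * s < e.
  rewrite -(ltr_pM2r M0); apply: le_lt_trans eM.
  rewrite -mulrA ger_pMr//.
  by rewrite /s invfM -mulrA mulVf ?mulr1 ?gt_eqF// invf_le1.
move=> /(_ se isT); apply/negP; rewrite -leNgt.
have le1 : (lebesgue_measure (A `&` ball x (2 * s)) <=
    ((2 * s) *+ 2 - (c * s) *+ 2)%:E)%E.
  apply: (@le_trans _ _ (lebesgue_measure (ball x (2 * s) `\` ball z (c * s)))).
    apply: le_measure; rewrite ?inE.
    - by apply: measurableI => //; exact: measurable_ball.
    - by apply: measurableD => //; exact: measurable_ball.
    - move=> y [Ay xy]; split=> // zy.
      by have : (A `&` ball z (c * s)) y by []; rewrite zA.
  rewrite measureD; [|exact: measurable_ball|exact: measurable_ball|].
    by rewrite setIidr// EFinB -mux -muz.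
  by apply: (@le_lt_trans _ _ ((2 * s) *+ 2)%:E); rewrite ?ltry -?mux.
rewrite mux inver gt_eqF ?mulrn_wgt0 ?mulr_gt0//.
apply: (@le_trans _ _ (((2 * s) *+ 2 - (c * s) *+ 2)%:E * ((2 * s *+ 2)^-1)%:E)%E).
  by rewrite lee_pmul2r// lte_fin invr_gt0 mulrn_wgt0// mulr_gt0.
rewrite -EFinM lee_fin ler_pdivrMr ?mulrn_wgt0 ?mulr_gt0//.
rewrite !mulr2n; have : 0 <= c * s by rewrite mulr_ge0// ltW.
by move=> ?; lra.
Qed.

Lemma unapproximable_small (R : realType) (c eta : R) (q : nat) :
  0 < c <= 1 -> (0 < q)%N -> 0 < eta ->
  exists K, (lebesgue_measure (unapproximable c q K `&` `[0%R, 1%R[) <= eta%:E)%E.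
Proof.
move=> c01 q0 eta0.
pose F K := unapproximable c q K `&` `[0%R, 1%R[%classic.
have mF K : measurable (F K).
  by apply: measurableI => //; exact: measurable_unapproximable.
have : lebesgue_measure \o F @ \oo --> lebesgue_measure (\bigcap_K F K).
  apply: nonincreasing_cvg_mu => //.
  - apply: (@le_lt_trans _ _ (lebesgue_measure (`[0%R, 1%R[%classic : set R))).
      apply: le_measure; rewrite ?inE; [exact: mF|by []|exact: subIsetr].
    by rewrite lebesgue_measure_itv/= lte_fin ltr01 oppr0 adde0 ltry.
  - exact: bigcapT_measurable.
  - move=> m n mn; apply/subsetPset => x [xn x01]; split=> // k /andP[k0 km].
    by apply: xn; rewrite k0 (leq_trans km).
have -> : lebesgue_measure (\bigcap_K F K) = 0%E.
  apply/eqP; rewrite -measure_le0 -(badly_approximable_null c01 q0).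
  apply: le_measure; rewrite ?inE.
  - exact: bigcapT_measurable.
  - by apply: bigcapT_measurable => K; exact: measurable_unapproximable.
  - by move=> x Fx K _; have [] := Fx K I.
move=> cv; have [] := cv [set y | (y < eta%:E)%E].
  by apply: open_nbhs_nbhs; split; [exact: open_ereal_lt_ereal|rewrite /= lte_fin].
by move=> K _ /(_ K (leqnn K)) /ltW FK; exists K.
Qed.

(** * Repetitions in the coding *)

(** One of the endpoints lies between x and y.  If I is unbounded on one side,
    the convention that makes [inf I] or [sup I] equal to 0 is harmless: a
    point outside I beyond x bounds I on the relevant side. *)
Lemma interval_endpoint_between (R : realType) (I : set R) (e x y : R) :
  is_interval I -> `|x - y| < e -> I x -> ~ I y ->
  exists2 d, d \in [:: inf I; sup I] & `|x - d| < e /\ `|y - d| < e.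
Proof.
move=> iI xye Ix nIy; have [xy|yx] := leP x y.
  exists (sup I); first by rewrite !inE eqxx orbT.
  have uby : ubound I y.
    move=> z Iz; rewrite leNgt; apply/negP => yz.
    by apply: nIy; apply: (iI x z); rewrite ?xy ?ltW.
  have sy : sup I <= y by apply: ge_sup => //; exists x.
  have xs : x <= sup I by apply: ub_le_sup => //; exists y.
  move: xye; rewrite !ltr_norml => /andP[? ?].
  by split; apply/andP; split; lra.
exists (inf I); first by rewrite !inE eqxx.
have lby : lbound I y.
  move=> z Iz; rewrite leNgt; apply/negP => zy.
  by apply: nIy; apply: (iI z x); rewrite ?(ltW zy) ?(ltW yx).
have sy : y <= inf I by apply: lb_le_inf => //; exists x.
have xs : inf I <= x by apply: ge_inf => //; exists y.
move: xye; rewrite !ltr_norml => /andP[? ?].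
by split; apply/andP; split; lra.
Qed.

Lemma circle_interval_boundary (R : realType) (A : set (circle R)) :
  circle_interval A -> exists D : seq R, forall (e x y : R),
    near_int e (y - x) -> (forall d, d \in D -> ~ near_int e (x - d)) ->
    A (circle_pi x) <-> A (circle_pi y).
Proof.
move=> [I iI ->]; exists [:: inf I; sup I] => e x y [m xym] far.
split=> -[z Iz /circle_piP[p zE]].
  have [Iy|nIy] := pselect (I (y + (p - m)%:~R)).
    by exists (y + (p - m)%:~R) => //; apply/circle_piP; exists (p - m).
  have [|d dD [zd _]] := @interval_endpoint_between _ I e z _ iI _ Iz nIy.
    rewrite distrC.
    by have -> : y + (p - m)%:~R - z = y - x - m%:~R by rewrite zE intrB; ring.
  case: (far d dD); exists (- p); rewrite intrN opprK.
  by have -> : x - d + p%:~R = z - d by rewrite zE; ring.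
have [Ix|nIx] := pselect (I (x + (p + m)%:~R)).
  by exists (x + (p + m)%:~R) => //; apply/circle_piP; exists (p + m).
have [|d dD [_ xd]] := @interval_endpoint_between _ I e z _ iI _ Iz nIx.
  have -> // : z - (x + (p + m)%:~R) = y - x - m%:~R.
  by rewrite zE intrD; ring.
case: (far d dD); exists (- (p + m)); rewrite intrN opprK.
by have -> : x - d + (p + m)%:~R = x + (p + m)%:~R - d by ring.
Qed.

(** The real numbers in D stand for their classes modulo 1: a move shorter than
    the distance from the starting point to these classes stays in the same
    atom. *)
Definition boundary_points (R : realType) (N : nat)
    (J : 'I_N -> set (circle R)) (D : seq R) : Prop :=
  forall (e x y : R), near_int e (y - x) ->
    (forall d, d \in D -> ~ near_int e (x - d)) ->
    forall l, J l (circle_pi x) <-> J l (circle_pi y).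

Lemma finite_boundary (R : realType) (N : nat) (J : 'I_N -> set (circle R)) :
  (forall l, circle_interval (J l)) -> exists D, boundary_points J D.
Proof.
move=> hJ.
have [D HD] := choice (fun l => @circle_interval_boundary _ _ (hJ l)).
exists (flatten [seq D l | l : 'I_N]) => e x y xy far l.
apply: (HD l e x y xy) => d dD; apply: far.
by apply/flattenP; exists (D l) => //; apply: map_f; rewrite mem_enum.
Qed.

Definition parabola {R : realType} (a b g : R) (t : int) : R :=
  a * (t ^+ 2)%:~R + b * t%:~R + g.

Lemma coding_parabola (R : realType) (N : nat) (J : 'I_N -> set (circle R))
    (lambda : 'I_N -> R) (a b g : R) (t t' : int) :
  (forall l, J l (circle_pi (parabola a b g t)) <->
             J l (circle_pi (parabola a b g t'))) ->
  coding J lambda (circle_pi a) (circle_pi b) (circle_pi g) t =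
  coding J lambda (circle_pi a) (circle_pi b) (circle_pi g) t'.
Proof.
move=> tt'; apply: eq_bigr => l _.
rewrite -!circle_pi_mulrz -!circle_piD -!/(parabola _ _ _ _) !indicE.
by congr (_ * (nat_of_bool _)%:R); apply/idP/idP; rewrite !inE => /tt'.
Qed.

(** Up to an integer the displacement is s w + q k b with s = a q - p and
    w = 2 k t + q k^2, and |w| <= (2 C + 1) q k^2. *)
Lemma parabola_return (R : realType) (a b g r e : R) (p : int) (q k C : nat)
    (t : int) :
  (0 < q)%N -> (0 < k)%N ->
  `|a * q%:R - p%:~R| < r -> r * ((2 * C + 1) * (q * k ^ 2))%:R <= e ->
  near_int e ((q * k)%:R * b) -> (`|t| <= C * (q * k))%N ->
  near_int (e + e) (parabola a b g (t + (q * k)%:Z) - parabola a b g t).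
Proof.
move=> q0 k0 aqp re nb tC.
set s := a * q%:R - p%:~R in aqp.
pose m : int := 2 * p * k%:Z * t + p * (q * k ^ 2)%:Z.
pose w : int := 2 * k%:Z * t + (q * k ^ 2)%:Z.
have -> : parabola a b g (t + (q * k)%:Z) - parabola a b g t =
    (s * w%:~R + (q * k)%:R * b) + m%:~R.
  rewrite /parabola /s /m /w !(intrD, intrM, rmorphXn) /= -!pmulrn.
  by rewrite !(natrM, natrX); ring.
apply/near_int_shift; apply: near_intD => //; exists 0; rewrite subr0.
have X0 : (0 : R) < ((2 * C + 1) * (q * k ^ 2))%:R.
  by rewrite ltr0n !muln_gt0 addn_gt0 orbT q0 k0.
apply: (lt_le_trans _ re).
apply: (@le_lt_trans _ _ (`|s| * ((2 * C + 1) * (q * k ^ 2))%:R)).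
  rewrite normrM ler_wpM2l// -intr_norm pmulrn ler_int.
  apply: (le_trans (ler_normD _ _)).
  have tC' : `|t| <= (C * (q * k))%:Z by rewrite -abszE lez_nat.
  rewrite !normrM !normr_nat.
  have := ler_wpM2l (_ : 0 <= 2 * k%:Z) tC'; rewrite mulr_ge0// => /(_ isT).
  by rewrite !PoszM !PoszD; nia.
by rewrite ltr_pM2r.
Qed.

(** Both halves of a two-sided match of length M = C q k compare the times t and
    t + q k: the forward half for 1 <= t <= M and the backward half for
    1 - M <= t <= 0.  This is why the 2 M times i + 1 - M with i < 2 M are
    the ones kept away from the boundary. *)
Lemma coding_two_sided_match (R : realType) (N : nat)
    (J : 'I_N -> set (circle R)) (D : seq R) (lambda : 'I_N -> R)
    (a b g r e : R) (p : int) (q k C : nat) :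
  boundary_points J D ->
  (0 < q)%N -> (0 < k)%N -> (0 < C)%N ->
  `|a * q%:R - p%:~R| < r -> r * ((2 * C + 1) * (q * k ^ 2))%:R <= e ->
  near_int e ((q * k)%:R * b) ->
  (forall (i : nat) (d : R), (i < 2 * (C * (q * k)))%N -> d \in D ->
    ~ near_int (e + e) (parabola a b g (i.+1%:Z - (C * (q * k))%:Z) - d)) ->
  two_sided_match (coding J lambda (circle_pi a) (circle_pi b) (circle_pi g))
    (q * k) (C * (q * k)).
Proof.
move=> HD q0 k0 C0 aqp re nb far.
have M0 : (0 < C * (q * k))%N by rewrite !muln_gt0 C0 q0.
have main (t : int) : 1 - (C * (q * k))%:Z <= t <= (C * (q * k))%:Z ->
    coding J lambda (circle_pi a) (circle_pi b) (circle_pi g) t =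
    coding J lambda (circle_pi a) (circle_pi b) (circle_pi g) (t + (q * k)%:Z).
  move=> tM; apply: coding_parabola; apply: (HD (e + e)).
    by apply: (parabola_return _ q0 k0 aqp re nb) => //; lia.
  move=> d dD.
  have [i -> iM] : exists2 i : nat, t = i.+1%:Z - (C * (q * k))%:Z &
      (i < 2 * (C * (q * k)))%N.
    by exists (absz (t - 1 + (C * (q * k))%:Z)); lia.
  exact: far.
move=> i /andP[i0 iM]; split; first by rewrite main//; lia.
rewrite (_ : _ + 1 - _ = 1 - i%:Z + (q * k)%:Z); last by lia.
by rewrite -main//; lia.
Qed.

Lemma two_sided_matchW (A : Type) (omega : int -> A) (n m m' : nat) :
  (m' <= m)%N -> two_sided_match omega n m -> two_sided_match omega n m'.
Proof. by move=> mm om k /andP[k0 km]; apply: om; rewrite k0 (leq_trans km). Qed.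

Lemma two_sided_match_forward (A : Type) (omega : int -> A) (n m : nat) :
  two_sided_match omega n m -> forward_match omega n m.
Proof. by move=> om k /om[]. Qed.

Lemma le_one_plus_nat_sup (R : realType) (M : set nat) (C n : nat) :
  (0 < n)%N -> M (C * n)%N ->
  (C%:R%:E <= 1 + (n%:R^-1)%:E * nat_sup R M)%E.
Proof.
move=> n0 MC; have n0R : (0 : R) < n%:R by rewrite ltr0n.
have h : ((C * n)%:R%:E <= nat_sup R M)%E.
  by apply: ereal_sup_ubound; right; exists (C * n)%N.
apply: (@le_trans _ _ ((n%:R^-1)%:E * nat_sup R M)%E); last first.
  by rewrite leeDr.
apply: (@le_trans _ _ ((n%:R^-1)%:E * (C * n)%:R%:E)%E).
  by rewrite -EFinM lee_fin natrM mulrCA mulVf ?mulr1 ?gt_eqF.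
by rewrite lee_pmul2l// lte_fin invr_gt0.
Qed.

Lemma limn_esup_pinfty (R : realType) (u : (\bar R)^nat) :
  (forall j, exists2 n, (j <= n)%N & (j%:R%:E <= u n)%E) ->
  limn_esup u = +oo%E.
Proof.
move=> uj; apply/eqP; rewrite -leye_eq; apply: le_ereal_inf_tmp.
move=> _ [V [m _ mV] <-]; rewrite leye_eq; apply/eqP/eqyP => A A0.
have [n jn jun] := uj (maxn m (Num.truncn A).+1).
apply: (@le_trans _ _ (u n)).
  apply: le_trans jun; rewrite lee_fin; apply/ltW/(lt_le_trans (truncnS_gt _)).
  by rewrite ler_nat leq_maxr.
apply: ereal_sup_ubound; exists n => //; apply: mV => /=.
by apply: leq_trans jn; exact: leq_maxl.
Qed.

Lemma rep_infinite (R : realType) (A : Type) (omega : int -> A) :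
  (forall j, exists2 n, (j < n)%N & two_sided_match omega n (j.+1 * n)) ->
  rep_R R omega = +oo%E /\ rep_T R omega = +oo%E.
Proof.
move=> om; split; apply: limn_esup_pinfty => j; have [n jn jm] := om j;
  exists n; rewrite 1?ltnW//; have n0 : (0 < n)%N by exact: leq_ltn_trans jn.
- apply: (@le_trans _ _ j.+1%:R%:E); first by rewrite lee_fin ler_nat.
  apply: le_one_plus_nat_sup => //; split; first by rewrite muln_gt0.
  exact: two_sided_match_forward.
- apply: (@le_trans _ _ j.+1%:R%:E); first by rewrite lee_fin ler_nat.
  by apply: le_one_plus_nat_sup => //; split; first by rewrite muln_gt0.
Qed.

(** * Pairs without a good repetition at a given level *)

Lemma measure_bigsetU_le d (T : measurableType d) (R : realType)
    (mu : {measure set T -> \bar R}) (I : Type) (s : seq I) (F : I -> set T)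
    (m : R) :
  (forall i, measurable (F i)) -> (forall i, (mu (F i) <= m%:E)%E) ->
  (mu (\big[setU/set0]_(i <- s) F i) <= ((size s)%:R * m)%:E)%E.
Proof.
move=> mF Fm; elim: s => [|i s IH]; first by rewrite big_nil measure0 mul0r.
rewrite big_cons; apply: le_trans (measureU2 _ _ _) _ => //.
  exact: bigsetU_measurable.
by rewrite /= mulrS mulrDl mul1r EFinD leeD.
Qed.

(** The factor 6 is crude but uniform in x: for e < 1 at most three integers are
    within e of the interval [x, x + 1[, and for e >= 1 the bound exceeds the
    total mass. *)
Lemma lebesgue_near_int (R : realType) (x e : R) : 0 <= e ->
  (lebesgue_measure ([set t : R | near_int e (x + t)%R] `&` `[0%R, 1%R[) <=
   (6 * e)%:E)%E.
Proof.
move=> e0.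
have mN : measurable ([set t : R | near_int e (x + t)] `&` `[0%R, 1%R[).
  apply: measurableI => //; apply: open_measurable.
  apply: (@open_comp _ _ (fun t : R => x + t)); last exact: open_near_int.
  by move=> t _; apply: cvgD; [exact: cvg_cst|exact: cvg_id].
have [e1|e1] := leP 1 e.
  apply: (@le_trans _ _ (lebesgue_measure (`[0%R, 1%R[%classic : set R))).
    by apply: le_measure; rewrite ?inE; [exact: mN|by []|exact: subIsetr].
  by rewrite lebesgue_measure_itv/= lte_fin ltr01 oppr0 adde0 lee_fin; lra.
pose m := Num.floor x.
pose F (i : nat) : set R := ball ((m + i%:Z)%:~R - x) e.
have mF i : measurable (F i) by exact: measurable_ball.
have muF i : (lebesgue_measure (F i) <= (e *+ 2)%:E)%E.
  by rewrite lebesgue_measure_ball.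
apply: (@le_trans _ _ (lebesgue_measure (\big[setU/set0]_(i <- iota 0 3) F i))).
  apply: le_measure; rewrite ?inE; [exact: mN|by apply: bigsetU_measurable => i _; exact: mF|].
  move=> t [[p xtp]]; rewrite /= in_itv/= => /andP[t0 t1].
  rewrite -bigcup_seq.
  have mx : m%:~R <= x by exact: ge_floor.
  have xm : x < m%:~R + 1 by rewrite -[1]/(1%:~R) -intrD; exact: floorD1_gt.
  move: (xtp); rewrite ltr_norml => /andP[xtp1 xtp2].
  have pm : (m - 1)%:~R < p%:~R :> R by rewrite intrB; lra.
  have pm3 : p%:~R < (m + 3)%:~R :> R by rewrite intrD; lra.
  rewrite !ltr_int in pm pm3.
  exists (absz (p - m)); first by rewrite /= !inE; lia.
  rewrite /F /ball/= (_ : m + _ = p); last by lia.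
  by have -> : p%:~R - x - t = - (x + t - p%:~R) by [ring]; rewrite normrN.
apply: (le_trans (@measure_bigsetU_le _ _ _ lebesgue_measure _ _ _ _ mF muF)).
by rewrite /= lee_fin mulr2n; lra.
Qed.

Lemma circle_lebesgue_near_int (R : realType) (x e : R) : 0 <= e ->
  (circle_lebesgue R [set u | near_int e (x + circle_rep u)%R] <= (6 * e)%:E)%E.
Proof.
move=> e0; have := lebesgue_near_int x e0.
by rewrite -(circle_lebesgue_rep [set t | near_int e (x + t)]).
Qed.

Lemma measurable_near_int d (T : measurableType d) (R : realType) (e : R)
    (f : T -> R) : measurable_fun setT f ->
  measurable [set x | near_int e (f x)].
Proof.
move=> mf; rewrite -[X in measurable X]setTI.
by apply: mf => //; apply: open_measurable; exact: open_near_int.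
Qed.

(** A point lying in all but finitely many of the F j lies in some tail
    intersection, whose measure is at most that of each of its members. *)
Lemma liminf_negligible d (T : measurableType d) (R : realType)
    (mu : {measure set T -> \bar R}) (F : (set T)^nat) :
  (forall j, measurable (F j)) ->
  (forall j, (mu (F j) <= (2 * j.+1%:R^-1)%:E)%E) ->
  mu.-negligible [set x | exists i, forall j, (i <= j)%N -> F j x].
Proof.
move=> mF muF.
have -> : [set x | exists i, forall j, (i <= j)%N -> F j x] =
    \bigcup_i \bigcap_(j in [set j | (i <= j)%N]) F j.
  apply/seteqP; split=> x [i]; first by move=> Fx; exists i.
  by move=> _ Fx; exists i.
apply: negligible_bigcup => i.
have mI : measurable (\bigcap_(j in [set j | (i <= j)%N]) F j).
  by apply: bigcap_measurable => //; exists i => /=.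
apply/negligibleP; first exact: mI.
apply/eqP; rewrite -measure_le0; apply/lee_addgt0Pr => e e0; rewrite add0e.
pose j := maxn i (Num.truncn (2 / e)).+1.
have ej : 2 / e < j.+1%:R.
  apply: (lt_le_trans (truncnS_gt _)); rewrite ler_nat.
  by rewrite (leq_trans (leq_maxr i _))// leqW.
apply: (@le_trans _ _ (mu (F j))).
  apply: le_measure; rewrite ?inE; [exact: mI|exact: mF|].
  by move=> x; apply; rewrite /= leq_maxl.
apply: (le_trans (muF j)); rewrite lee_fin ler_pdivrMr//.
by rewrite mulrC -ler_pdivrMr// ltW.
Qed.

(** Here a is a lift of alpha, and c / k bounds both the distance from q k beta
    to the integers and the drift caused by the error of p / q; the whole
    displacement over the time q k is thus below c / k + c / k, which is the
    distance to keep from the points of D. *)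
Section no_good_return.
Context {R : realType}.
Variables (a c : R) (D : seq R) (q K C : nat).

Definition return_time_set (k : nat) : set (circle R * circle R) :=
  [set bg | near_int (c / k%:R) ((q * k)%:R * circle_rep bg.1)].

Definition near_boundary_set (k : nat) : set (circle R * circle R) :=
  \big[setU/set0]_(z <- [seq (i, d) | i <- iota 0 (2 * (C * (q * k))), d <- D])
    [set bg | near_int (c / k%:R + c / k%:R)
      (parabola a (circle_rep bg.1) (circle_rep bg.2)
         (z.1.+1%:Z - (C * (q * k))%:Z) - z.2)].

Definition no_good_return : set (circle R * circle R) :=
  ~` \bigcup_(k in [set k | (0 < k <= K)%N])
       (return_time_set k `\` near_boundary_set k).

Lemma measurable_no_good_return : measurable no_good_return.
Proof.
have m1 : measurable_fun [set: circle R * circle R]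
    (fun bg => circle_rep bg.1).
  by apply: measurableT_comp; [exact: measurable_circle_rep|].
have m2 : measurable_fun [set: circle R * circle R]
    (fun bg => circle_rep bg.2).
  by apply: measurableT_comp; [exact: measurable_circle_rep|].
apply: measurableC; apply: bigcup_measurable => k _; apply: measurableD.
  by apply: measurable_near_int; exact: measurable_funM.
apply: bigsetU_measurable => z _; apply: measurable_near_int.
apply: measurable_funB => //; apply: measurable_funD => //.
by apply: measurable_funD => //; exact: measurable_funM.
Qed.

(** Fix one k that is good for b.  There are 2 C q k times and [size D] points,
    and each pair excludes a set of gamma of measure at most 6 (2 c / k); the
    product is 24 C q (size D) c, independent of k. *)
Lemma xsection_no_good_return (b : circle R) (eta : R) :
  0 < c -> 24 * C%:R * q%:R * (size D)%:R * c <= eta ->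
  ~ unapproximable c q K (circle_rep b) ->
  (circle_lebesgue R (xsection no_good_return b) <= eta%:E)%E.
Proof.
move=> c0 ceta /existsNP[k /not_implyP[kK /contrapT bk]].
have /andP[k0 _] := kK; have k0R : (0 : R) < k%:R by rewrite ltr0n.
pose e := c / k%:R + c / k%:R; have e0 : 0 <= e.
  by rewrite addr_ge0// divr_ge0// ltW.
pose s := [seq (i, d) | i <- iota 0 (2 * (C * (q * k))), d <- D].
pose F (z : nat * R) : set (circle R) := [set g | near_int e
  ((parabola a (circle_rep b) 0 (z.1.+1%:Z - (C * (q * k))%:Z) - z.2)
    + circle_rep g)].
have mF z : measurable (F z).
  apply: measurable_near_int; apply: measurable_funD => //.
  exact: measurable_circle_rep.
apply: (@le_trans _ _ (circle_lebesgue R (\big[setU/set0]_(z <- s) F z))).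
  apply: le_measure; rewrite ?inE.
  - by apply: measurable_xsection; exact: measurable_no_good_return.
  - by apply: bigsetU_measurable => z _; exact: mF.
  - move=> g; rewrite /xsection/= inE => ng; apply: contrapT => sg.
    apply: ng; exists k => //; split=> //.
    rewrite /near_boundary_set -bigcup_seq => -[z zs zg].
    apply: sg; rewrite -bigcup_seq; exists z => //; rewrite /F /=.
    move: zg => /=; rewrite -/e; set t := (_ - _ : int).
    have -> // : parabola a (circle_rep b) (circle_rep g) t - z.2 =
        parabola a (circle_rep b) 0 t - z.2 + circle_rep g.
    by rewrite /parabola; ring.
apply: (le_trans (@measure_bigsetU_le _ _ _ (circle_lebesgue R) _ s F (6 * e) mF _)).
  by move=> z; exact: circle_lebesgue_near_int.
rewrite lee_fin; apply: le_trans ceta.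
rewrite size_allpairs size_iota !natrM /e le_eqVlt; apply/orP; left; apply/eqP.
by field; rewrite gt_eqF.
Qed.

(** Fubini: the section over b has measure at most eta, except for those b in a
    set of measure at most eta, where it is bounded by 1. *)
Lemma no_good_return_le (eta : R) :
  0 < c -> 24 * C%:R * q%:R * (size D)%:R * c <= eta ->
  (lebesgue_measure (unapproximable c q K `&` `[0%R, 1%R[) <= eta%:E)%E ->
  ((circle_lebesgue R \x circle_lebesgue R) no_good_return <=
    (2 * eta)%:E)%E.
Proof.
move=> c0 ceta mueta.
have eta0 : 0 <= eta.
  by apply: le_trans ceta; rewrite !mulr_ge0// ltW.
pose U := @circle_rep R @^-1` unapproximable c q K.
have mU : measurable U.
  rewrite -[U]setTI; apply: measurable_circle_rep => //.
  exact: measurable_unapproximable.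
rewrite /product_measure1/=.
apply: (@le_trans _ _ (\int[circle_lebesgue R]_x ((\1_U x)%:E + (cst eta x)%:E))%E).
  apply: ge0_le_integral => //.
  - by apply: measurable_fun_xsection; exact: measurable_no_good_return.
  - by apply: emeasurable_funD; apply/measurable_EFinP => //; exact: measurable_indic.
  move=> b _ /=; have [Ub|nUb] := pselect (U b).
    rewrite indicE mem_set//= -EFinD.
    apply: (@le_trans _ _ 1%E); last by rewrite lee_fin lerDl.
    apply: probability_le1.
    by apply: measurable_xsection; exact: measurable_no_good_return.
  apply: (@le_trans _ _ eta%:E); last first.
    by rewrite -EFinD lee_fin lerDr indicE.
  exact: xsection_no_good_return.
rewrite ge0_integralD//=; last first.
  by apply/measurable_EFinP; exact: measurable_indic.
have mu1 : circle_lebesgue R setT = 1%E by exact: probability_setT.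
rewrite integral_indic// setIT integral_cst// [X in (_ + _ * X)%E]mu1 mule1.
rewrite mulrDl mul1r EFinD leeD2r//.
apply: le_trans mueta.
by rewrite -(circle_lebesgue_rep (unapproximable c q K)).
Qed.

End no_good_return.

(** * The residual set of frequencies *)

(** A value of c that makes the bound 24 C q (size D) c with C = j + 1 at most
    1 / (j + 1) and that is itself at most 1; the successor of [size D] only
    prevents a division by 0. *)
Definition tolerance {R : realType} (D : seq R) (j q : nat) : R :=
  (24 * j.+1%:R * q%:R * (size D).+1%:R * j.+1%:R)^-1.

(** How close a q must be to an integer for the drift over C n to stay below
    c / k for all k <= K: the drift is at most proximity * (2 C + 1) q k^2, and
    k^3 <= K^3.  The successor of K keeps it positive when K = 0. *)
Definition proximity {R : realType} (D : seq R) (K : nat -> nat -> nat)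
    (j q : nat) : R :=
  tolerance D j q / ((2 * j.+1 + 1) * (q * (K j q).+1 ^ 3))%:R.

(** The condition j < q makes the repetition times q k tend to infinity with the
    level j. *)
Definition well_approximable {R : realType} (D : seq R)
    (K : nat -> nat -> nat) (j : nat) : set R :=
  [set x | exists (q : nat) (p : int), (j < q)%N /\
     `|x * q%:R - p%:~R| < proximity D K j q].

Lemma tolerance_gt0 (R : realType) (D : seq R) (j q : nat) :
  (0 < q)%N -> 0 < tolerance D j q.
Proof. by move=> q0; rewrite invr_gt0 !mulr_gt0// ltr0n. Qed.

Lemma tolerance_le1 (R : realType) (D : seq R) (j q : nat) :
  (0 < q)%N -> tolerance D j q <= 1.
Proof.
move=> q0; rewrite invf_le1; first by rewrite !mulr_ege1// ler1n.
by rewrite !mulr_gt0// ltr0n.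
Qed.

Lemma tolerance_boundary (R : realType) (D : seq R) (j q : nat) : (0 < q)%N ->
  24 * j.+1%:R * q%:R * (size D)%:R * tolerance D j q <= j.+1%:R^-1.
Proof.
move=> q0; have q0R : (0 : R) < q%:R by rewrite ltr0n.
have s0 : (0 : R) < (size D).+1%:R by rewrite ltr0n.
have j0 : (0 : R) < j.+1%:R by rewrite ltr0n.
have -> : 24 * j.+1%:R * q%:R * (size D)%:R * tolerance D j q =
    ((size D)%:R / (size D).+1%:R) * j.+1%:R^-1.
  by rewrite /tolerance; field; rewrite !gt_eqF.
by rewrite ger_pMl ?invr_gt0// ler_pdivrMr// mul1r ler_nat.
Qed.

Lemma proximity_gt0 (R : realType) (D : seq R) K (j q : nat) :
  (0 < q)%N -> 0 < proximity D K j q.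
Proof.
move=> q0; rewrite divr_gt0 ?tolerance_gt0// ltr0n.
by rewrite !muln_gt0 q0 addn1.
Qed.

Lemma proximity_drift (R : realType) (D : seq R) K (j q k : nat) :
  (0 < q)%N -> (0 < k <= K j q)%N ->
  proximity D K j q * ((2 * j.+1 + 1) * (q * k ^ 2))%:R <=
  tolerance D j q / k%:R.
Proof.
move=> q0 /andP[k0 kK]; have k0R : (0 : R) < k%:R by rewrite ltr0n.
rewrite /proximity -mulrA ler_pM2l ?tolerance_gt0//.
rewrite mulrC ler_pdivrMr; last by rewrite ltr0n !muln_gt0 q0 addn1.
rewrite mulrC ler_pdivlMr// -natrM ler_nat.
have : (k ^ 2 * k <= (K j q).+1 ^ 3)%N by rewrite -expnSr leq_exp2r// leqW.
move: (k ^ 2)%N ((K j q).+1 ^ 3)%N => k2 K3 kK3.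
by rewrite -!mulnA !leq_mul.
Qed.

Lemma open_well_approximable (R : realType) (D : seq R) K j :
  open (well_approximable D K j).
Proof.
have -> : well_approximable D K j = \bigcup_(q in [set q | (j < q)%N])
    \bigcup_(p : int)
      (fun x : R => x * q%:R) @^-1` ball (p%:~R : R) (proximity D K j q).
  apply/seteqP; split=> x.
    move=> [q [p [jq xqp]]]; exists q => //; exists p => //.
    by rewrite /ball/= distrC.
  move=> [q jq [p _]]; rewrite /ball/= => xqp.
  by exists q, p; split=> //; rewrite distrC.
apply: bigcup_open => q _; apply: bigcup_open => p _.
apply: open_comp; last exact: ball_open.
by move=> x _; exact: mulrr_continuous.
Qed.

(** The fraction need not be reduced: multiplying numerator and denominator by
    j + 1 makes the denominator exceed j while the error stays 0. *)
Lemma ratr_well_approximable (R : realType) (D : seq R) K j (w : rat) :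
  well_approximable D K j (ratr w).
Proof.
have d0 : (0 < absz (denq w))%N by rewrite absz_gt0 denq_neq0.
have q0 : (j < j.+1 * absz (denq w))%N by exact: leq_pmulr.
exists (j.+1 * absz (denq w))%N, (j.+1%:Z * numq w); split=> //.
rewrite (_ : _ - _ = 0) ?normr0 ?proximity_gt0 ?(leq_ltn_trans _ q0)//.
have dR : (absz (denq w))%:R = (denq w)%:~R :> R.
  by rewrite -[in RHS](gtz0_abs (denq_gt0 w)).
have d0R : (denq w)%:~R != 0 :> R by rewrite intr_eq0 denq_neq0.
by rewrite natrM dR intrM /ratr -pmulrn; field.
Qed.

Lemma dense_circle_rational (R : realType) (S : set (circle R)) :
  (forall w : rat, S (circle_pi (ratr w))) -> dense S.
Proof.
move=> Sw O [u Ou] oO; have [x xu] := circle_pi_surj u.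
have [|y [Oy [w _ wy]]] := @dense_rat R (@circle_pi R @^-1` O) _ oO.
  by exists x; rewrite /= xu.
by exists (circle_pi (ratr w)); split=> //; rewrite wy.
Qed.

Unset Implicit Arguments.
Set Strict Implicit.

Theorem theorem9 (R : realType) (N : nat) (J : 'I_N -> set (circle R)) :
  partition [set: 'I_N] J [set: circle R] ->
  (forall l : 'I_N, circle_interval (J l)) ->
  exists Res : set (circle R),
    [/\ dense Res, Gdelta Res
      & forall alpha : circle R, Res alpha ->
        forall lambda : 'I_N -> R, injective lambda ->
        {ae (circle_lebesgue R \x circle_lebesgue R)%E,
          forall bg : circle R * circle R,
            rep_R R (coding J lambda alpha bg.1 bg.2) = +oo%E /\
            rep_T R (coding J lambda alpha bg.1 bg.2) = +oo%E}].
Proof.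
move=> _ /finite_boundary[D HD].
(* The bound K on k, depending on the level j and the denominator q. *)
have /choice[K' HK'] : forall jq : nat * nat, exists K, (0 < jq.2)%N ->
    (lebesgue_measure (unapproximable (tolerance D jq.1 jq.2) jq.2 K `&`
       `[0%R, 1%R[) <= (jq.1.+1%:R^-1)%:E)%E.
  move=> [j q] /=; have [->|q0] := posnP q; first by exists 0%N.
  have [||K HK] := @unapproximable_small R (tolerance D j q) j.+1%:R^-1 q _ q0.
  - by rewrite tolerance_gt0//= tolerance_le1.
  - by rewrite invr_gt0.
  - by exists K.
pose K j q := K' (j, q).
pose O j := @circle_pi R @` well_approximable D K j.
exists (\bigcap_j O j); split.
- apply: dense_circle_rational => w j _.
  by exists (ratr w) => //; exact: ratr_well_approximable.
- exists O => // j; apply: circle_pi_open; exact: open_well_approximable.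
move=> alpha Oalpha lambda _.
(* At each level alpha has its own lift a j, because the approximation property
   is stated for real numbers. *)
have /choice[a Ha] : forall j, exists x, well_approximable D K j x /\
    circle_pi x = alpha.
  by move=> j; have [x] := Oalpha j I; exists x.
have /choice[q Hq] : forall j, exists q : nat, (j < q)%N /\ exists p : int,
    `|a j * q%:R - p%:~R| < proximity D K j q.
  by move=> j; have [[q [p [jq ajq]]] _] := Ha j; exists q; split=> //; exists p.
pose F j := no_good_return (a j) (tolerance D j (q j)) D (q j) (K j (q j)) j.+1.
have q0 j : (0 < q j)%N by have [jq _] := Hq j; exact: leq_ltn_trans jq.
have : ((circle_lebesgue R \x circle_lebesgue R)%E).-negligible
    [set bg | exists i, forall j, (i <= j)%N -> F j bg].
  apply: liminf_negligible => j; first exact: measurable_no_good_return.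
  apply: no_good_return_le; first exact: tolerance_gt0.
    exact: tolerance_boundary.
  by have := HK' (j, q j) (q0 j).
apply: negligibleS => -[b g]; apply: contra_notP => nF.
apply: rep_infinite => i.
have [j ij /contrapT[k kK [kb kbd]]] : exists2 j, (i <= j)%N & ~ F j (b, g).
  apply: contrapT => nj; apply: nF; exists i => j ij.
  by apply: contrapT => nFj; apply: nj; exists j.
have [jq [p ajp]] := Hq j; have [_ <-] := Ha j.
have /andP[k0 _] := kK.
exists (q j * k)%N.
  by rewrite (leq_ltn_trans ij)// (leq_trans jq)// leq_pmulr.
apply: (@two_sided_matchW _ _ _ (j.+1 * (q j * k))).
  by rewrite leq_mul2r ltnS ij orbT.
rewrite /= -(circle_repK b) -(circle_repK g).
have drift := proximity_drift D (q0 j) kK.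
apply: (coding_two_sided_match _ HD _ _ _ ajp drift) => //.
move=> l d lM dD near_d; apply: kbd; rewrite /near_boundary_set -bigcup_seq.
exists (l, d) => //=; apply/allpairsP; exists (l, d).
by rewrite mem_iota add0n leq0n lM.
Qed.
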